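(* Let $d=2$ and $u_h^0\in V_h$. For each $n\ge0$, given $u_h^n=\sum_{i\in\mathcal V}U_i^n\phi_i\in V_h$, let $w_h^{n+1}=\sum_{i\in\mathcal V}W_i^{n+1}\phi_i\in V_h$ be given by $$m_i\frac{W_i^{n+1}-U_i^n}{\tau}+\sum_{j\in\mathcal I(i)}\Big(\mathbf f(U_j^n)\cdot\mathbf c_{ij}-d_{ij}^n(U_j^n-U_i^n)\Big)=0\qquad\forall i\in\mathcal V,$$ and let $(u_h^{n+1},z_h^{n+1},g_h^{n+1})\in V_h\times V_h\times V_h$ satisfy, for all $(v_h,r_h,s_h)\in V_h\times V_h\times V_h$, $$\begin{aligned} &\Big(\frac{u_h^{n+1}-w_h^{n+1}}{\tau},v_h\Big)-\epsilon(\partial_xz_h^{n+1},\partial_xv_h)-\epsilon(\partial_xg_h^{n+1},\partial_yv_h)\\ &\qquad-\epsilon c(z_h^{n+1}-\partial_xu_h^{n+1},\partial_xv_h)-\epsilon c(g_h^{n+1}-\partial_yu_h^{n+1},\partial_yv_h)=0,\\ &(z_h^{n+1}-\partial_xu_h^{n+1},c\,r_h-\partial_xr_h)=0,\qquad(g_h^{n+1}-\partial_yu_h^{n+1},c\,s_h-\partial_xs_h)=0, \end{aligned}$$ or the same system in which the first term of the first equation is replaced by its lumped-mass version $\sum_{i\in\mathcal V}m_i\frac{U_i^{n+1}-W_i^{n+1}}{\tau}V_i$ for $v_h=\sum_{i}V_i\phi_i$. Then for all $n\ge0$, $$\int_Du_h^{n+1}\,dx=\dots=\int_Du_h^0\,dx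 .$$
   Context: Setting. $D=[a,b]^2$ with coordinates $(x,y)$, $\mathbf f:\mathbb R\to\mathbb R^2$ is Lipschitz, $\epsilon>0$ and $c>0$ are constants, $\tau>0$ is the time step (which may depend on $n$), $(\cdot,\cdot)$ is the $L^2(D)$ inner product. Finite element space. $\mathcal K_h$ is a mesh of $D$ (from a shape-regular family, covering $D$ exactly); $T_K:\hat K\to K$ is the affine map from the reference element; $\hat P$ is the polynomial space of the reference element. $V_h$ is the space of $v\in C^0(D)$, periodic with respect to $D$, with $v|_K\circ T_K\in\hat P$ for all $K\in\mathcal K_h$. $\mathcal V=\{1,\dots,I\}$ enumerates the degrees of freedom and $\{\phi_i\}_{i\in\mathcal V}$ is the basis of global shape functions of $V_h$, with $\sum_i\phi_i=1$. $\mathcal I(i)=\{j\in\mathcal V:\phi_j\phi_i\not\equiv0\}$, $m_i=\int_D\phi_i\,dx$ (assumed $>0$), $\mathbf c_{ij}=\int_D\phi_i\nabla\phi_j\,dx$, $\mathbf n_{ij}=\mathbf c_{ij}/\|\mathbf c_{ij}\|_{l^2}$ (Euclidean norm). Graph viscosity. $\lambda_{\max}(\mathbf n,U_L,U_R)$ is an upper bound on the maximum wave speed in the one-dimensional Riemann problem $\partial_tu+\partial_x(\mathbf f(u)\cdot\mathbf n)=0$ with left state $U_L$ and right state $U_R$, and $d_{ij}^n=\max(\lambda_{\max}(\mathbf n_{ij},U_i^n,U_j^n)\|\mathbf c_{ij}\|_{l^2},\lambda_{\max}(\mathbf n_{ji},U_j^n,U_i^n)\|\mathbf c_{ji}\|_{l^2})$,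 a term with $\mathbf c_{ij}=0$ being understood as $0$. *)

(* Defs.v *)
From HB Require Import structures.
From mathcomp Require Import all_boot all_order all_algebra.
From mathcomp Require Import all_classical all_reals all_analysis.

Set Implicit Arguments.
Unset Strict Implicit.
Unset Printing Implicit Defensive.

Import Order.TTheory GRing.Theory Num.Theory.
Import numFieldNormedType.Exports.

Local Open Scope classical_set_scope.
Local Open Scope ring_scope.

Notation R2 R := (R^o * R^o)%type.
Notation leb2 R := ((@lebesgue_measure R) \x (@lebesgue_measure R))%E.

Definition dotp (R : realType) (p q : R2 R) : R := p.1 * q.1 + p.2 * q.2.

(* The library norm on a product type is the sup norm, hence this definition. *)
Definition norm2 (R : realType) (p : R2 R) : R := Num.sqrt (dotp p p).

Definition square (R : realType) (a b : R) : set (R2 R) :=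
  `[a, b] `*` `[a, b].

Definition int2 (R : realType) (A : set (R2 R)) (v : R2 R -> R) : R :=
  (\int[leb2 R]_(p in A) v p)%R.

Definition inner (R : realType) (A : set (R2 R)) (v w : R2 R -> R) : R :=
  int2 A (fun p => v p * w p).

(* Classical partial derivatives, totalized by the library at the points where
   they do not exist.  A continuous piecewise polynomial function on the square
   has them almost everywhere, and there they are its weak partial derivatives;
   the values on the boundary of the square, a null set, are irrelevant. *)
Definition dx (R : realType) (v : R2 R -> R) (p : R2 R) : R :=
  'D_((1, 0) : R2 R) (v : R2 R -> R^o) p.
Definition dy (R : realType) (v : R2 R -> R) (p : R2 R) : R :=
  'D_((0, 1) : R2 R) (v : R2 R -> R^o) p.

Definition polyfun (R : realType) (q : {poly {poly R}}) (p : R2 R) : R :=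
  q.[(p.1)%:P].[p.2].

(* The shape of the reference element (triangle, square, ...) is not fixed; the
   space ref_space is a finite-dimensional space of bivariate polynomials. *)
Record ref_element (R : realType) := RefElement {
  ref_cell : set (R2 R);
  ref_space : set {poly {poly R}};
  ref_compact : compact ref_cell;
  ref_connected : connected ref_cell;
  ref_interior : ref_cell° !=set0;
  ref_finite_dim : exists s : seq {poly {poly R}},
    ref_space =
    [set q | exists al : nat -> R, q = \sum_(k < size s) (al k)%:P *: s`_k] }.

Definition affine_iso (R : realType) (T : R2 R -> R2 R) : Prop :=
  exists (L : {linear (R2 R) -> (R2 R)}) (t : R2 R),
    bijective L /\ forall p, T p = L p + t.

Record mesh (R : realType) (E : ref_element R) (D : set (R2 R)) := Mesh {
  cell_index : finType;
  geom : cell_index -> R2 R -> R2 R;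
  geom_affine : forall K, affine_iso (geom K);
  mesh_cover : \bigcup_K (geom K @` ref_cell E) = D;
  mesh_disjoint : forall K L, K != L ->
    (geom K @` ref_cell E)° `&` (geom L @` ref_cell E)° = set0 }.

Definition cell (R : realType) (E : ref_element R) (D : set (R2 R))
  (M : mesh E D) (K : cell_index M) : set (R2 R) := geom K @` ref_cell E.

Definition diameter (R : realType) (A : set (R2 R)) : R :=
  sup [set norm2 (p - q) | p in A & q in A].

Definition inner_diameter (R : realType) (A : set (R2 R)) : R :=
  sup [set 2 * r | r in
         [set r : R | 0 < r /\ exists p, [set q | norm2 (q - p) < r] `<=` A]].

Definition shape_regular (R : realType) (E : ref_element R) (D : set (R2 R))
    (H : Type) (M : H -> mesh E D) : Prop :=
  exists sigma : R, forall h (K : cell_index (M h)),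
    diameter (cell K) <= sigma * inner_diameter (cell K).

Definition periodic_on (R : realType) (a b : R) (v : R2 R -> R) : Prop :=
  forall s, a <= s <= b -> v (a, s) = v (b, s) /\ v (s, a) = v (s, b).

(* V_h; its elements are functions on the square, represented by functions on
   the plane whose values outside the square are immaterial. *)
Definition fe_space (R : realType) (E : ref_element R) (a b : R)
    (M : mesh E (square a b)) : set (R2 R -> R) :=
  [set v | [/\ {within square a b, continuous v}, periodic_on a b v &
     forall K : cell_index M, exists2 q, ref_space E q &
       forall p, ref_cell E p -> v (geom K p) = polyfun q p]].

Definition fe_fun (R : realType) (N : nat) (phi : 'I_N -> R2 R -> R)
  (V : 'I_N -> R) (p : R2 R) : R := \sum_(i < N) V i * phi i p.

Definition fe_basis (R : realType) (D : set (R2 R)) (Vh : set (R2 R -> R))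
    (N : nat) (phi : 'I_N -> R2 R -> R) : Prop :=
  [/\ forall i, Vh (phi i),
      forall v, Vh v -> exists V, forall p, D p -> v p = fe_fun phi V p &
      forall V, (forall p, D p -> fe_fun phi V p = 0) -> forall i, V i = 0].

Definition stencil (R : realType) (D : set (R2 R)) (N : nat)
    (phi : 'I_N -> R2 R -> R) (i : 'I_N) : set 'I_N :=
  [set j | exists2 p, D p & phi j p * phi i p != 0].

Definition lumped_mass (R : realType) (D : set (R2 R)) (N : nat)
  (phi : 'I_N -> R2 R -> R) (i : 'I_N) : R := int2 D (phi i).

Definition cvec (R : realType) (D : set (R2 R)) (N : nat)
    (phi : 'I_N -> R2 R -> R) (i j : 'I_N) : R2 R :=
  (inner D (phi i) (dx (phi j)), inner D (phi i) (dy (phi j))).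

Definition normalize (R : realType) (p : R2 R) : R2 R := (norm2 p)^-1 *: p.

(* If the vector c_ij is zero, the corresponding argument of the maximum is
   lam _ _ _ * 0 = 0. *)
Definition graph_viscosity (R : realType) (D : set (R2 R)) (N : nat)
    (phi : 'I_N -> R2 R -> R) (lam : R2 R -> R -> R -> R) (U : 'I_N -> R)
    (i j : 'I_N) : R :=
  let cij := cvec D phi i j in let cji := cvec D phi j i in
  Num.max (lam (normalize cij) (U i) (U j) * norm2 cij)
          (lam (normalize cji) (U j) (U i) * norm2 cji).

(* Points of the plane are (t, x) from here to wave_speed_bound. *)
Definition test_function (R : realType) (psi : R2 R -> R) : Prop :=
  [/\ forall p, 0 <= psi p,
      forall p, differentiable (psi : R2 R -> R^o) p,
      continuous (dx psi) /\ continuous (dy psi) &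
      exists M : R, forall p, M < norm2 p -> psi p = 0].

(* Kruzhkov entropy solutions of u_t + F(u)_x = 0, t > 0, u(0, .) = u0. *)
Definition entropy_solution (R : realType) (F : R -> R) (u0 : R -> R)
    (u : R2 R -> R) : Prop :=
  [/\ measurable_fun setT u, exists M : R, forall p, `|u p| <= M &
      forall (k : R) (psi : R2 R -> R), test_function psi ->
        0 <= int2 [set p | 0 < p.1]
               (fun p => `|u p - k| * dx psi p
                         + Num.sg (u p - k) * (F (u p) - F k) * dy psi p)
             + (\int[@lebesgue_measure R]_x (`|u0 x - k| * psi (0, x)))%R].

Definition riemann_data (R : realType) (UL UR : R) (x : R) : R :=
  if x < 0 then UL else UR.

(* s bounds the moduli of all wave speeds of the Riemann problem: its entropy
   solution is undisturbed outside the cone |x| <= s t. *)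
Definition wave_speed_bound (R : realType) (F : R -> R) (UL UR s : R) : Prop :=
  0 <= s /\
  forall u, entropy_solution F (riemann_data UL UR) u ->
    {ae leb2 R, forall p, 0 < p.1 ->
       (p.2 < - (s * p.1) -> u p = UL) /\ (s * p.1 < p.2 -> u p = UR)}.

Definition graph_viscosity_step (R : realType) (D : set (R2 R)) (N : nat)
    (phi : 'I_N -> R2 R -> R) (lam : R2 R -> R -> R -> R) (f : R -> R2 R)
    (tau : R) (U W : 'I_N -> R) : Prop :=
  forall i, lumped_mass D phi i * ((W i - U i) / tau)
    + \sum_(j < N | `[< stencil D phi i j >])
        (dotp (f (U j)) (cvec D phi i j)
         - graph_viscosity D phi lam U i j * (U j - U i)) = 0.

Definition regularization_terms (R : realType) (D : set (R2 R)) (eps c : R)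
    (u z g v : R2 R -> R) : R :=
  - eps * inner D (dx z) (dx v) - eps * inner D (dx g) (dy v)
  - eps * c * inner D (fun p => z p - dx u p) (dx v)
  - eps * c * inner D (fun p => g p - dy u p) (dy v).

Definition auxiliary_equations (R : realType) (D : set (R2 R))
    (Vh : set (R2 R -> R)) (c : R) (u z g : R2 R -> R) : Prop :=
  (forall r, Vh r ->
     inner D (fun p => z p - dx u p) (fun p => c * r p - dx r p) = 0) /\
  (forall s, Vh s ->
     inner D (fun p => g p - dy u p) (fun p => c * s p - dx s p) = 0).

Definition consistent_system (R : realType) (D : set (R2 R))
    (Vh : set (R2 R -> R)) (eps c tau : R) (u w z g : R2 R -> R) : Prop :=
  (forall v, Vh v ->
     inner D (fun p => (u p - w p) / tau) v
     + regularization_terms D eps c u z g v = 0) /\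
  auxiliary_equations D Vh c u z g.

Definition lumped_system (R : realType) (D : set (R2 R))
    (Vh : set (R2 R -> R)) (N : nat) (phi : 'I_N -> R2 R -> R)
    (eps c tau : R) (U W : 'I_N -> R) (z g : R2 R -> R) : Prop :=
  (forall V : 'I_N -> R,
     \sum_(i < N) lumped_mass D phi i * ((U i - W i) / tau) * V i
     + regularization_terms D eps c (fe_fun phi U) z g (fe_fun phi V) = 0) /\
  auxiliary_equations D Vh c (fe_fun phi U) z g.

(* Main.v *)
Require Import Defs.
From HB Require Import structures.
From mathcomp Require Import all_boot all_order all_algebra.
From mathcomp Require Import polyXY.
From mathcomp Require Import all_classical all_reals all_analysis.
From mathcomp Require Import measurable_realfun.

Set Implicit Arguments.
Unset Strict Implicit.
Unset Printing Implicit Defensive.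

Import Order.TTheory GRing.Theory Num.Theory.
Import numFieldNormedType.Exports.

Local Open Scope classical_set_scope.
Local Open Scope ring_scope.

(** The total mass of the function with coefficients V is the sum of the m_i V_i
    (int2_fe_fun), and both halves of a time step preserve it.

    Explicit step (graph_scheme_conservative).  Summed over i, the viscous
    terms cancel in pairs because d_ij is symmetric, and the fluxes leave the
    sum over j of f(U_j) . C_j, where C_j is the sum over i of the c_ij.  Since
    the phi_i sum to 1, C_j is the integral of the gradient of phi_j, which
    vanishes by periodicity (sum_cvec).  The inner sums may run over all j, since
    c_ij and d_ij vanish outside the stencil (cvec_out_stencil).

    Regularized step (regularization_conservative).  The constant 1 is an
    admissible test function; its gradient is zero, hence so is every
    regularization term, and what remains says that u and w have the same mass,
    in the consistent as well as in the lumped version.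

    The analytic core is that the gradient of phi_j, the classical derivative
    wherever it exists, has integral zero.  The cells may have wild boundaries
    and the functions are arbitrary outside the square, so the argument avoids
    the geometry of the mesh altogether: it only uses that finitely many
    polynomials P suffice for a continuous function on the square to agree at
    every point with one of them (fe_space_selection).  Let Q be a nonzero
    polynomial vanishing on the boundary of the square and wherever two distinct
    ones among the P agree (separating_exists).  Its zero set is null
    (polyfun_null), and on the open complement O every phi_j coincides near each
    point with one of the P (selection_piecewise), so that phi_j and its derivatives are continuous and
    bounded on O.  All but finitely many lines parallel to an axis meet the zero
    set of Q in finitely many points; on them the fundamental theorem of calculus
    for a continuous function differentiable off a finite set
    (FTC_off_finite) and periodicity give a zero integral, and Fubini's theorem
    concludes (int2_dx_periodic, int2_dy_periodic). *)

(** * Bivariate polynomial functions *)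

Section BivariatePolynomials.
Variable R : realType.
Implicit Types P Q : {poly {poly R}}.

(** Two nested inductions on univariate polynomials amount to structural
    induction on polynomial expressions in two variables. *)
Lemma bipoly_ind (K : {poly {poly R}} -> Prop) :
  (forall k, K k%:P%:P) -> K 'X -> K 'X%:P ->
  (forall P Q, K P -> K Q -> K (P + Q)) ->
  (forall P Q, K P -> K Q -> K (P * Q)) -> forall P, K P.
Proof.
move=> KC KX KY KD KM P; elim/poly_ind: P => [|P c KP]; first exact: (KC 0).
apply: (KD); first exact: KM.
elim/poly_ind: c => [|c k Kc]; first exact: (KC 0).
by rewrite polyCD polyCM; apply: (KD) => //; exact: KM.
Qed.

Lemma polyfunC k p : polyfun (k%:P%:P : {poly {poly R}}) p = k.
Proof. by rewrite /polyfun !hornerC. Qed.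

Lemma polyfunX (p : R2 R) : polyfun 'X p = p.1.
Proof. by rewrite /polyfun hornerX hornerC. Qed.

Lemma polyfunY (p : R2 R) : polyfun 'X%:P p = p.2.
Proof. by rewrite /polyfun hornerC hornerX. Qed.

Lemma polyfunD P Q p : polyfun (P + Q) p = polyfun P p + polyfun Q p.
Proof. by rewrite /polyfun !hornerD. Qed.

Lemma polyfunB P Q p : polyfun (P - Q) p = polyfun P p - polyfun Q p.
Proof. by rewrite /polyfun !hornerD !hornerN. Qed.

Lemma polyfunM P Q p : polyfun (P * Q) p = polyfun P p * polyfun Q p.
Proof. by rewrite /polyfun !hornerM. Qed.

Lemma polyfun_swapXY P x y :
  polyfun (swapXY P) (x, y) = polyfun P (y, x).
Proof.
elim/bipoly_ind: P => [k| | |P Q hP hQ|P Q hP hQ].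
- by rewrite swapXY_polyC map_polyC/= !polyfunC.
- by rewrite swapXY_X polyfunX polyfunY.
- by rewrite swapXY_Y polyfunX polyfunY.
- by rewrite rmorphD !polyfunD hP hQ.
- by rewrite rmorphM !polyfunM hP hQ.
Qed.

Lemma polyfun_col P x y : polyfun P (x, y) = P.[x%:P].[y].
Proof. by []. Qed.

Lemma polyfun_row P x y : polyfun P (x, y) = (swapXY P).[y%:P].[x].
Proof. by rewrite -polyfun_swapXY. Qed.

(** In a pair of nested polynomials the outer variable is the first coordinate,
    so coefficientwise derivation differentiates in the second one. *)
Definition dpolyX P : {poly {poly R}} := swapXY (map_poly deriv (swapXY P)).
Definition dpolyY P : {poly {poly R}} := map_poly deriv P.

Lemma horner_map_deriv P (c : R) : (map_poly deriv P).[c%:P] = P.[c%:P]^`().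
Proof.
elim/poly_ind: P => [|P d IH]; first by rewrite map_poly0 !horner0 deriv0.
have -> : map_poly deriv (P * 'X + d%:P) = map_poly deriv P * 'X + (d^`())%:P.
  apply/polyP => i; rewrite coef_map_id0 ?deriv0// !coefD !coefMX !coefC.
  case: i => [|i] /=; rewrite ?add0r ?addr0//.
  by rewrite coef_map_id0 ?deriv0.
by rewrite !hornerE derivD derivM derivC mulr0 addr0 IH.
Qed.

Lemma is_derive_polyfun_row P (x y : R) :
  is_derive x (1 : R) (fun t : R => polyfun P (t, y) : R) (polyfun (dpolyX P) (x, y)).
Proof.
rewrite polyfun_row /dpolyX swapXYK horner_map_deriv.
rewrite (_ : (fun t => _) = horner (swapXY P).[y%:P]); last first.
  by apply/funext => t; rewrite polyfun_row.
exact: is_derive_poly.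
Qed.

Lemma is_derive_polyfun_col P (x y : R) :
  is_derive y (1 : R) (fun t : R => polyfun P (x, t) : R) (polyfun (dpolyY P) (x, y)).
Proof. by rewrite polyfun_col horner_map_deriv; exact: (is_derive_poly P.[x%:P] y). Qed.

Lemma continuous_polyfun P : continuous (polyfun P : R2 R -> R).
Proof.
elim/bipoly_ind: P => [k| | |P Q hP hQ|P Q hP hQ] p.
- rewrite (_ : polyfun _ = cst k); first exact: cvg_cst.
  by apply/funext => q; rewrite polyfunC.
- rewrite (_ : polyfun _ = fst); first exact: cvg_fst.
  by apply/funext => q; rewrite polyfunX.
- rewrite (_ : polyfun _ = snd); first exact: cvg_snd.
  by apply/funext => q; rewrite polyfunY.
- rewrite (_ : polyfun _ = polyfun P \+ polyfun Q); last first.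
    by apply/funext => q; rewrite polyfunD.
  exact: (@cvgD _ _ _ _ _ (polyfun P) (polyfun Q) _ _ (hP p) (hQ p)).
- rewrite (_ : polyfun _ = polyfun P \* polyfun Q); last first.
    by apply/funext => q; rewrite polyfunM.
  exact: (@cvgM _ _ _ _ (polyfun P) (polyfun Q) _ _ (hP p) (hQ p)).
Qed.

Lemma itv_norm_le (a b x : R) : a <= x <= b -> `|x| <= `|a| + `|b|.
Proof.
move=> /andP[ax xb]; rewrite ler_norml; apply/andP; split.
  rewrite lerNl (@le_trans _ _ `|a|) ?lerDl//.
  by rewrite (@le_trans _ _ (- a)) ?lerN2// -normrN ler_norm.
by rewrite (le_trans xb)// (le_trans (ler_norm b))// lerDr.
Qed.

Lemma polyfun_bounded a b P :
  exists M, forall p, square a b p -> `|polyfun P p| <= M.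
Proof.
elim/bipoly_ind: P => [k| | |P Q [M hM] [L hL]|P Q [M hM] [L hL]].
- by exists `|k| => p _; rewrite polyfunC.
- exists (`|a| + `|b|) => -[x y] [/= + _].
  by rewrite polyfunX in_itv/= ; exact: itv_norm_le.
- exists (`|a| + `|b|) => -[x y] [/= _].
  by rewrite polyfunY in_itv/= ; exact: itv_norm_le.
- exists (M + L) => p Dp; rewrite polyfunD (le_trans (ler_normD _ _))//.
  by rewrite lerD ?hM ?hL.
- by exists (M * L) => p Dp; rewrite polyfunM normrM ler_pM ?hM ?hL.
Qed.

Lemma polyfun_comp P A B :
  exists Q, forall p, polyfun Q p = polyfun P (polyfun A p, polyfun B p).
Proof.
elim/bipoly_ind: P => [k| | |P Q [M hM] [L hL]|P Q [M hM] [L hL]].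
- by exists k%:P%:P => p; rewrite !polyfunC.
- by exists A => p; rewrite polyfunX.
- by exists B => p; rewrite polyfunY.
- by exists (M + L) => p; rewrite !polyfunD hM hL.
- by exists (M * L) => p; rewrite !polyfunM hM hL.
Qed.

Lemma poly_finite_roots (F : idomainType) (q : {poly F}) :
  q != 0 -> exists s : seq F, forall x, root q x -> x \in s.
Proof.
have [n] := ubnP (size q); elim: n q => // n IH q; rewrite ltnS => qn q0.
have [[x /factor_theorem[r qE]]|nr] := pselect (exists x, root q x); last first.
  by exists [::] => x rx; exfalso; apply: nr; exists x.
have r0 : r != 0 by apply: contraNneq q0 => r0; rewrite qE r0 mul0r.
have [|s hs] := IH r _ r0.
  by rewrite (leq_trans _ qn)// qE size_Mmonic ?monicXsubC// size_XsubC addn2.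
exists (x :: s) => y; rewrite qE rootM root_XsubC inE => /orP[/hs ->|->//].
by rewrite orbT.
Qed.

(** A nonzero Q has finitely many outer roots in the domain of univariate
    polynomials; for every other x the specialization of Q at x is a nonzero
    polynomial in y. *)
Lemma polyfun_cofinite_col Q : Q != 0 -> exists s : seq R, forall x, x \notin s ->
  exists t : seq R, forall y, polyfun Q (x, y) = 0 -> y \in t.
Proof.
move=> /poly_finite_roots[s hs]; exists (map (fun q : {poly R} => q`_0) s) => x xs.
have : Q.[x%:P] != 0.
  apply: contra xs => rx; apply/mapP; exists x%:P; last by rewrite coefC.
  exact: hs.
by move=> /poly_finite_roots[t ht]; exists t => y Qxy; apply: ht; apply/eqP.
Qed.

Lemma polyfun_cofinite_row Q : Q != 0 -> exists s : seq R, forall y, y \notin s ->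
  exists t : seq R, forall x, polyfun Q (x, y) = 0 -> x \in t.
Proof.
rewrite -swapXY_eq0 => /polyfun_cofinite_col[s hs]; exists s => y /hs[t ht].
by exists t => x; rewrite -polyfun_swapXY; exact: ht.
Qed.

End BivariatePolynomials.

(** * One-variable calculus off a finite set *)

Section OneVariable.
Variable R : realType.
Notation mu := (@lebesgue_measure R).

(** Cut the interval at each exceptional point; on the pieces this is the mean
    value theorem. *)
Lemma constant_off_finite (s : seq R) (G : R -> R) (a b : R) : a <= b ->
  {within `[a, b], continuous G} ->
  (forall x, x \in `]a, b[ -> x \notin s -> derivable G x 1 /\ 'D_1 G x = 0) ->
  G a = G b.
Proof.
elim: s a b => [|c s IH] a b; rewrite le_eqVlt => /predU1P[->//|ab] cG dG.
  have dG0 x : x \in `]a, b[ -> is_derive x (1 : R) G (cst 0 x).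
    by move=> xab; have [] := dG x xab erefl; exact: DeriveDef.
  have [c _] := MVT ab dG0 cG.
  by rewrite mul0r => /eqP; rewrite subr_eq0 => /eqP.
have [/andP[ac cb]|cab] := boolP (a < c < b).
  transitivity (G c).
  - apply: (IH a c) => [||x]; first exact: ltW.
      apply: continuous_subspaceW cG => x /=; rewrite !in_itv/= => /andP[-> xc].
      by rewrite (le_trans xc) ?ltW.
    rewrite in_itv/= => /andP[ax xc] xs; apply: dG.
      by rewrite in_itv/= ax (lt_trans xc).
    by rewrite inE (lt_eqF xc).
  - apply: (IH c b) => [||x]; first exact: ltW.
      apply: continuous_subspaceW cG => x /=; rewrite !in_itv/= => /andP[cx ->].
      by rewrite (le_trans _ cx) ?ltW.
    rewrite in_itv/= => /andP[cx xb] xs; apply: dG.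
      by rewrite in_itv/= xb (lt_trans ac).
    by rewrite inE (gt_eqF cx).
apply: (IH a b) => [||x xab xs]; [exact: ltW|exact: cG|apply: dG => //].
rewrite inE negb_or xs andbT; apply: contra cab => /eqP <-.
by move: xab; rewrite in_itv.
Qed.

(** The indefinite integral of f and F have the same derivative off s, and their
    difference is continuous. *)
Lemma FTC_off_finite (s : seq R) (F f : R -> R) (a b : R) : a < b ->
  {within `[a, b], continuous F} -> mu.-integrable `[a, b] (EFin \o f) ->
  (forall x, x \in `]a, b[ -> x \notin s ->
     [/\ derivable F x 1, 'D_1 F x = f x & {for x, continuous f}]) ->
  (\int[mu]_(x in `[a, b]) f x)%R = F b - F a.
Proof.
move=> ab cF intf dF; pose H x := (\int[mu]_(t in `[a, x]) f t)%R.
have cH : {within `[a, b], continuous H}.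
  exact: parameterized_integral_continuous (ltW ab) intf.
have : (H \- F) a = (H \- F) b.
  apply: (@constant_off_finite s); first exact: ltW.
    by move=> x; apply: continuousB; [exact: cH|exact: cF].
  move=> x xab xs; have [dFx FE cfx] := dF x xab xs.
  move: xab; rewrite in_itv/= => /andP[ax xb].
  have [dH HE] := continuous_FTC1_closed xb intf ax cfx.
  rewrite -/H in dH HE.
  split; first exact: derivableB.
  by rewrite deriveB// FE -derive1E HE subrr.
rewrite /= {1}/H set_itv1 Rintegral_set1 sub0r => /eqP.
by rewrite eq_sym subr_eq addrC => /eqP.
Qed.

End OneVariable.

(** * Integrals of arbitrary functions and null sets *)

Section LowerIntegral.
Local Open Scope ereal_scope.
Context d (T : measurableType d) (R : realType).
Variable mu : {measure set T -> \bar R}.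
Import HBNNSimple.

(** The integral of a nonnegative function, measurable or not, is a supremum over
    the simple functions below it, and multiplying those by the indicator of the
    complement of N does not change their integrals.  This generality is needed
    because derivatives on the boundary of the square depend on arbitrary values
    outside. *)
Lemma ge0_integral_setC_null (N : set T) (f : T -> \bar R) :
  measurable N -> mu N = 0 -> (forall x, 0 <= f x) ->
  \int[mu]_x f x = \int[mu]_(x in ~` N) f x.
Proof.
move=> mN N0 f0; have f0' x : 0 <= (f \_ (~` N)) x.
  by rewrite patchE; case: ifPn.
rewrite [RHS]integral_mkcond (ge0_integralTE _ f0) (ge0_integralTE _ f0') /=.
apply/eqP; rewrite eq_le; apply/andP; split; last first.
  apply: le_ereal_sup => _ [h hf <-]; exists h => // x.
  by apply: (le_trans (hf x)); rewrite patchE; case: ifPn.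
apply: ge_ereal_sup => _ [h hf <-].
pose k := proj_nnsfun h (measurableC mN).
have kE : (k : T -> R) = (h : T -> R) \_ (~` N) by rewrite -mrestrict.
apply: ereal_sup_ubound => /=; exists k.
  by move=> x; rewrite kE !patchE; case: ifPn.
rewrite -!integralT_nnsfun [RHS](@ge0_negligible_integral _ _ _ mu _ N)//.
- rewrite [RHS]integral_mkcond setTD; apply: eq_integral => x _.
  by rewrite kE !patchE; case: ifPn.
- by apply/measurable_EFinP.
- by move=> x _; rewrite lee_fin.
Qed.

Lemma integral_setD_null (D N : set T) (f : T -> \bar R) :
  measurable N -> mu N = 0 ->
  \int[mu]_(x in D) f x = \int[mu]_(x in D `\` N) f x.
Proof.
move=> mN N0; rewrite integralE [RHS]integralE.
have E (g : T -> \bar R) : (forall x, 0 <= g x) ->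
    \int[mu]_(x in D) g x = \int[mu]_(x in D `\` N) g x.
  move=> g0; rewrite integral_mkcond (ge0_integral_setC_null mN N0).
    by rewrite setDE integral_mkcondl.
  by move=> x; rewrite patchE; case: ifPn.
by rewrite (E _ (funepos_ge0 f)) (E _ (funeneg_ge0 f)).
Qed.

End LowerIntegral.

(** * Measurability and null sets in the plane *)

Section PlaneMeasurability.
Variable R : realType.
Notation mu := (@lebesgue_measure R).

(** An open set of the plane is a countable union of boxes with rational centres. *)
Lemma open_measurable2 (O : set (R2 R)) : open O -> measurable O.
Proof.
move=> oO; pose B (n : nat) (q r : rat) : set (R2 R) :=
  ball (ratr q : R^o) n.+1%:R^-1 `*` ball (ratr r : R^o) n.+1%:R^-1.
have -> : O = \bigcup_n \bigcup_q \bigcup_r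
    (if `[< B n q r `<=` O >] then B n q r else set0).
  apply/seteqP; split => [[x y] Oxy|p [n _ [q _ [r _]]]]; last first.
    by case: asboolP => // + Bp; exact.
  have [e /= e0 eO] : exists2 e : R, 0 < e & ball ((x, y) : R2 R) e `<=` O.
    by apply/nbhs_ballP; apply: open_nbhs_nbhs.
  have [n ne] : exists n : nat, n.+1%:R^-1 < e / 2.
    have e20 : 0 < e / 2 by rewrite divr_gt0.
    have [n _ hn] := near_infty_natSinv_lt (PosNum e20); exists n.
    exact: (hn n (leqnn n)).
  have apx (t : R) : exists q : rat, `|ratr q - t| < n.+1%:R^-1.
    have [|q] := @rat_in_itvoo _ (t - n.+1%:R^-1) (t + n.+1%:R^-1).
      by rewrite ltrBlDr -addrA ltrDl addr_gt0 ?invr_gt0.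
    by rewrite in_itv/= -ltr_distlC => tq; exists q; rewrite distrC.
  have [[q qx] [r ry]] := (apx x, apx y).
  exists n => //; exists q => //; exists r => //; rewrite ifT; first by split.
  apply/asboolP => -[x' y'] [/= qx' ry']; apply: eO; split => /=.
    by apply: (@ball_splitr _ _ (ratr q : R^o)); apply: (le_ball (ltW ne)).
  by apply: (@ball_splitr _ _ (ratr r : R^o)); apply: (le_ball (ltW ne)).
apply: bigcupT_measurable => n; apply: bigcupT_measurable_rat => q.
apply: bigcupT_measurable_rat => r; case: ifPn => // _.
by apply: measurableX; exact: measurable_ball.
Qed.

Lemma open_continuous_measurable2 (O : set (R2 R)) (g : R2 R -> R) :
  open O -> (forall p, O p -> {for p, continuous g}) -> measurable_fun O g.
Proof.
move=> oO cg; apply: (measurability _ (RGenOpens.measurableE R)).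
move=> _ [_ [a [b ->] <-]]; apply: open_measurable2.
rewrite openE => p [Op gp]; apply: filterI; first exact: open_nbhs_nbhs.
by apply: (cg p Op); apply: open_nbhs_nbhs; split => //; exact: interval_open.
Qed.

Lemma finite_lebesgue_null (s : seq R) (A : set R) :
  (forall x, A x -> x \in s) -> mu A = 0%E.
Proof.
move=> As; apply: countable_lebesgue_measure0; apply: finite_set_countable.
by apply: sub_finite_set (finite_seq s) => x /As.
Qed.

Lemma open_polyfun_neq0 (Q : {poly {poly R}}) :
  open [set p : R2 R | polyfun Q p != 0].
Proof.
rewrite openE => p /= Qp.
exact: (cvgr_neq0 _ (@continuous_polyfun R Q p) Qp).
Qed.

Lemma measurable_polyfun_zero (Q : {poly {poly R}}) :
  measurable [set p : R2 R | polyfun Q p = 0].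
Proof.
rewrite [X in measurable X](_ : _ = ~` [set p | polyfun Q p != 0]).
  by apply: measurableC; apply: open_measurable2; exact: open_polyfun_neq0.
by apply/seteqP; split => p /=; [move=> ->; rewrite eqxx|move/negP/negPn/eqP].
Qed.

(** All vertical sections but finitely many are finite. *)
Lemma polyfun_null (Q : {poly {poly R}}) : Q != 0 ->
  leb2 R [set p : R2 R | polyfun Q p = 0] = 0%E.
Proof.
move=> /polyfun_cofinite_col[s hs]; set Z := [set p | _].
have mZ : measurable Z by exact: measurable_polyfun_zero.
rewrite /product_measure1.
rewrite (ae_eq_integral (cst 0%E))//; first exact: integral0.
  exact: measurable_fun_xsection.
exists [set x | x \in s]; split.
- apply: countable_measurable; first exact: measurable_set1.
  exact/finite_set_countable/finite_seq.
- exact: (finite_lebesgue_null (s := s)).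
- move=> x /= nx; apply: contrapT => xs; apply: nx => _.
  have /hs[t ht] : x \notin s by apply/negP.
  apply: (finite_lebesgue_null (s := t)) => y; rewrite /xsection/= inE.
  exact: ht.
Qed.
End PlaneMeasurability.

(** * Locally polynomial functions *)

Section PiecewisePolynomials.
Variable R : realType.
Implicit Types (O : set (R2 R)) (g v : R2 R -> R) (Ps : seq {poly {poly R}}).

(** Local agreement with members of a fixed finite list: the finiteness gives
    boundedness, the locality gives continuity and differentiability. *)
Definition piecewise_poly O Ps g := forall p, O p ->
  exists2 P, P \in Ps & \forall q \near p, g q = polyfun P q.

(** Partial derivatives are derivatives along lines, even as totalized values. *)
Lemma dxE v (x y : R) : dx v (x, y) = 'D_1 (fun t : R => v (t, y) : R) x.
Proof.
have E : (fun h : R =>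
      h^-1 *: (((v : R2 R -> R^o) \o shift (x, y)) (h *: ((1, 0) : R2 R)) - v (x, y))) =
    (fun h : R => h^-1 *: (((fun t : R => v (t, y) : R) \o shift x) (h *: (1 : R)) - v (x, y))).
  by apply/funext => h /=; congr (_ *: (v (_, _) - _)); rewrite /= scaler0 add0r.
exact: (congr1 (fun F : R -> R => lim (F @ 0^')) E).
Qed.

Lemma dyE v (x y : R) : dy v (x, y) = 'D_1 (fun t : R => v (x, t) : R) y.
Proof.
have E : (fun h : R =>
      h^-1 *: (((v : R2 R -> R^o) \o shift (x, y)) (h *: ((0, 1) : R2 R)) - v (x, y))) =
    (fun h : R => h^-1 *: (((fun t : R => v (x, t) : R) \o shift y) (h *: (1 : R)) - v (x, y))).
  by apply/funext => h /=; congr (_ *: (v (_, _) - _)); rewrite /= scaler0 add0r.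
exact: (congr1 (fun F : R -> R => lim (F @ 0^')) E).
Qed.

Lemma near_eq_dx v w (p : R2 R) : (\near p, v p = w p) -> dx v p = dx w p.
Proof. exact: (@near_eq_derive R _ R^o v w p). Qed.

Lemma near_eq_dy v w (p : R2 R) : (\near p, v p = w p) -> dy v p = dy w p.
Proof. exact: (@near_eq_derive R _ R^o v w p). Qed.

Lemma dx_polyfun P (p : R2 R) : dx (polyfun P) p = polyfun (dpolyX P) p.
Proof.
by case: p => x y; rewrite dxE; have [_ ->] := is_derive_polyfun_row P x y.
Qed.

Lemma dy_polyfun P (p : R2 R) : dy (polyfun P) p = polyfun (dpolyY P) p.
Proof.
by case: p => x y; rewrite dyE; have [_ ->] := is_derive_polyfun_col P x y.
Qed.

Lemma piecewise_dx O Ps g : piecewise_poly O Ps g ->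
  piecewise_poly O (map (@dpolyX R) Ps) (dx g).
Proof.
move=> h p /h[P PPs gP]; exists (dpolyX P); first exact: map_f.
by apply: filterS (near_join gP) => q gPq; rewrite (near_eq_dx gPq) dx_polyfun.
Qed.

Lemma piecewise_dy O Ps g : piecewise_poly O Ps g ->
  piecewise_poly O (map (@dpolyY R) Ps) (dy g).
Proof.
move=> h p /h[P PPs gP]; exists (dpolyY P); first exact: map_f.
by apply: filterS (near_join gP) => q gPq; rewrite (near_eq_dy gPq) dy_polyfun.
Qed.

Lemma piecewise_mul O Ps Qs g v :
  piecewise_poly O Ps g -> piecewise_poly O Qs v ->
  piecewise_poly O [seq P * Q | P <- Ps, Q <- Qs] (fun p => g p * v p).
Proof.
move=> hg hv p Op; have [[P PPs gP] [Q QQs vQ]] := (hg p Op, hv p Op).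
exists (P * Q); first exact: allpairs_f.
by near=> q; rewrite polyfunM (near gP)// (near vQ).
Unshelve. all: by end_near. Qed.

Lemma piecewise_continuous O Ps g (p : R2 R) : piecewise_poly O Ps g -> O p ->
  {for p, continuous g}.
Proof.
move=> h /h[P _ gP]; have := @continuous_polyfun R P p.
rewrite /prop_for /continuous_at (nbhs_singleton gP).
by apply: cvg_trans; apply: near_eq_cvg; near do apply/esym.
Unshelve. all: by end_near. Qed.

Lemma polyfun_seq_bounded a b Ps :
  exists M, forall P p, P \in Ps -> square a b p -> `|polyfun P p| <= M.
Proof.
elim: Ps => [|P Ps [M hM]]; first by exists 0.
have [L hL] := polyfun_bounded a b P; exists (Num.max M L) => Q p.
rewrite inE le_max => /predU1P[->|QPs] Dp; first by rewrite hL ?orbT.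
by rewrite hM.
Qed.

Lemma leb2_square_lty a b : (leb2 R (square a b) < +oo)%E.
Proof.
have fin : (@lebesgue_measure R `[a, b] < +oo)%E.
  by rewrite lebesgue_measure_itv/=; case: ifP => _; rewrite ?ltry.
rewrite /square product_measure1E; [|exact: measurable_itv|exact: measurable_itv].
by apply: lte_mul_pinfty => //; rewrite ge0_fin_numE.
Qed.

Lemma piecewise_integrable a b O Ps g : open O -> O `<=` square a b ->
  piecewise_poly O Ps g -> (leb2 R).-integrable O (EFin \o g).
Proof.
move=> oO OD hg; have mO := open_measurable2 oO.
apply: measurable_bounded_integrable => //.
- apply: le_lt_trans (leb2_square_lty a b); apply: le_measure => //; rewrite inE//.
  by apply: measurableX; exact: measurable_itv.
- apply: open_continuous_measurable2 => // p Op.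
  exact: piecewise_continuous hg Op.
- have [M hM] := polyfun_seq_bounded a b Ps; exists M; split; first exact: num_real.
  move=> L ML p /= Op; have [P PPs /nbhs_singleton ->] := hg p Op.
  by rewrite (le_trans (hM _ _ PPs (OD _ Op)))// ltW.
Qed.

End PiecewisePolynomials.

(** * The regular set of a family of polynomials *)

Section RegularSet.
Variable R : realType.
Notation mu := (@lebesgue_measure R).
Implicit Types (g v : R2 R -> R) (Ps : seq {poly {poly R}}) (a b : R).

Definition regular_set a b (Q : {poly {poly R}}) : set (R2 R) :=
  square a b `&` [set p | polyfun Q p != 0].

(** Q acts as a discriminant: away from its zeros a continuous selection among Ps
    cannot switch from one polynomial to another. *)
Definition separating a b Ps (Q : {poly {poly R}}) : Prop :=
  [/\ Q != 0,
      forall p, regular_set a b Q p -> (p.1 \in `]a, b[) && (p.2 \in `]a, b[) &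
      forall P P', P \in Ps -> P' \in Ps -> P != P' ->
        forall p, polyfun Q p != 0 -> polyfun P p != polyfun P' p].

(** Take the product of the four linear factors vanishing on the sides of the
    square and of all the differences of distinct members of Ps. *)
Lemma separating_exists a b Ps : exists Q, separating a b Ps Q.
Proof.
pose B : {poly {poly R}} := ('X - a%:P%:P) * ('X - b%:P%:P)
  * ('X%:P - a%:P%:P) * ('X%:P - b%:P%:P).
have polyXsubC_neq0 (F : idomainType) (k : F) : 'X - k%:P != 0 :> {poly F}.
  by rewrite monic_neq0// monicXsubC.
have B0 : B != 0.
  by rewrite !mulf_neq0// ?polyXsubC_neq0// -polyCB polyC_eq0 polyXsubC_neq0.
exists (B * \prod_(P <- Ps) \prod_(P' <- Ps | P != P') (P - P')); split.
- rewrite mulf_neq0// prodf_seq_neq0; apply/allP => P _ /=.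
  rewrite prodf_seq_neq0; apply/allP => P' _; apply/implyP => PP'.
  by rewrite subr_eq0.
- move=> [x y] [[/=]]; rewrite !in_itv/= => /andP[ax xb] /andP[ay yb].
  rewrite !polyfunM !polyfunB polyfunX polyfunY !polyfunC/= !mulf_eq0 !negb_or !subr_eq0.
  move=> /andP[/andP[/andP[/andP[xa xb']] ya] yb'] _.
  by rewrite !lt_neqAle ax xb ay yb (eq_sym a x) (eq_sym a y) xa xb' ya yb'.
- move=> P P' PPs P'Ps PP' p; apply: contraNneq => PP'p.
  rewrite (big_rem P)//= (big_rem P')//= PP' !polyfunM polyfunB PP'p subrr.
  by rewrite !(mul0r, mulr0).
Qed.

Lemma open_regular_set a b Ps Q : separating a b Ps Q -> open (regular_set a b Q).
Proof.
case=> _ bQ _; rewrite [regular_set a b Q](_ : _ =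
    ((`]a, b[ : set R^o) `*` (`]a, b[ : set R^o)) `&` [set p : R2 R | polyfun Q p != 0]).
  apply: openI; last exact: open_polyfun_neq0.
  rewrite openE => -[x y] [/= xab yab].
  by exists (`]a, b[, `]a, b[)%classic => //=; split;
    apply: open_nbhs_nbhs; split => //; exact: interval_open.
apply/seteqP; split => [p Op|p [[xab yab] Qp]]; last first.
  by split => //; split; apply: subset_itv_oo_cc.
by split; [have /andP[] := bQ p Op|case: Op].
Qed.

Lemma regular_subset a b Q : regular_set a b Q `<=` square a b.
Proof. by move=> p []. Qed.

Lemma int2_regular a b Q g : Q != 0 ->
  int2 (square a b) g = int2 (regular_set a b Q) g.
Proof.
move=> Q0; rewrite /int2 /Rintegral; congr fine.
have mZ := measurable_polyfun_zero Q.
have nZ := polyfun_null Q0.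
rewrite (@integral_setD_null _ _ R (leb2 R) (square a b) _ (EFin \o g) mZ nZ).
congr integral; apply/seteqP; split => p [Dp /= Qp]; split => //=; first exact/eqP.
by move=> Qp0; move: Qp; rewrite Qp0 eqxx.
Qed.

(** Near a regular point p, where v agrees with P, the other members of Ps stay
    away from v by continuity, so v can only select P. *)
Lemma selection_piecewise a b Ps Q v : separating a b Ps Q ->
  {within square a b, continuous v} ->
  (forall p, square a b p -> exists2 P, P \in Ps & v p = polyfun P p) ->
  piecewise_poly (regular_set a b Q) Ps v.
Proof.
move=> sQ cv sel p Op; have oO := open_regular_set sQ; have [_ _ sep] := sQ.
have nO : nbhs p (regular_set a b Q) by exact: open_nbhs_nbhs.
have cvp : {for p, continuous v}.
  have /subspace_continuousP/(_ p (regular_subset Op)) := cv.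
  rewrite within_interior//; apply: filterS nO; exact: regular_subset.
have [P PPs vP] := sel p (regular_subset Op).
exists P => //.
have away (S : seq {poly {poly R}}) : {subset S <= Ps} ->
    \forall q \near p, forall P', P' \in S -> P' != P -> v q != polyfun P' q.
  elim: S => [|P' S IH] SPs; first by near=> q.
  have [|P'P] := eqVneq P' P.
    move=> ->; have := IH (fun x xS => SPs x (mem_behead (s := P' :: S) xS)).
    apply: filterS => q h P2; rewrite inE => /predU1P[->|]; last exact: h.
    by rewrite eqxx.
  have dP' : v p - polyfun P' p != 0.
    rewrite subr_eq0 vP; apply: (sep P P') => //; first exact/SPs/mem_head.
      by rewrite eq_sym.
    by case: Op.
  have cd : (fun q => v q - polyfun P' q) @ p --> v p - polyfun P' p.
    exact: (@cvgB _ _ _ _ _ v (polyfun P') _ _ cvp (@continuous_polyfun R P' p)).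
  have nz : \forall q \near p, v q - polyfun P' q != 0.
    exact: (cvgr_neq0 _ cd dP').
  have aw := IH (fun x xS => SPs x (mem_behead (s := P' :: S) xS)).
  apply: filterS2 aw nz => q h1 h2 P2; rewrite inE => /predU1P[->|]; last exact: h1.
  by move=> _; rewrite -subr_eq0.
have aw := away Ps (fun _ => id); apply: filterS2 nO aw => q Oq aw.
have [P' P'Ps vP'] := sel q (regular_subset Oq).
have [<-//|P'P] := eqVneq P' P.
by have := aw P' P'Ps P'P; rewrite vP' eqxx.
Unshelve. all: by end_near. Qed.

Lemma piecewise_restrict (O : set (R2 R)) Ps g : open O ->
  piecewise_poly O Ps g -> piecewise_poly O Ps (g \_ O).
Proof.
move=> oO hg p Op; have [P PPs gP] := hg p Op; exists P => //.
have := open_nbhs_nbhs (conj oO Op); apply: filterS2 gP => q gq Oq.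
by rewrite patchE mem_set.
Qed.

End RegularSet.

(** * The gradient of a periodic function has integral zero *)

Section GradientIntegral.
Variable R : realType.
Notation mu := (@lebesgue_measure R).
Implicit Types (v : R2 R -> R) (Ps : seq {poly {poly R}}) (a b : R).

(** On one line of the square the exceptional points are finite in number, and
    the boundary values of F cancel. *)
Lemma slice_integral0 (s : seq R) (F f : R -> R) a b : a < b ->
  {within `[a, b], continuous F} -> F a = F b ->
  mu.-integrable setT (EFin \o f) -> (forall t, t \notin `]a, b[ -> f t = 0) ->
  (forall t, t \in `]a, b[ -> t \notin s ->
     [/\ derivable F t 1, 'D_1 F t = f t & {for t, continuous f}]) ->
  (\int[mu]_t (f t)%:E = 0)%E.
Proof.
move=> ab cF Fab intf f0 dF.
have intfab : mu.-integrable `[a, b] (EFin \o f).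
  by apply: integrableS intf => //; exact: measurable_itv.
have := FTC_off_finite ab cF intfab dF; rewrite Fab subrr => fab0.
transitivity (\int[mu]_(t in `[a, b]) (f t)%:E)%E.
  rewrite [RHS]integral_mkcond; apply: eq_integral => t _.
  rewrite patchE; case: ifPn => // /negP tab; rewrite f0//.
  by apply/negP => tab'; apply: tab; rewrite inE; exact: subset_itv_oo_cc.
by rewrite -[RHS]/(0%:E) -fab0 fineK//; apply: integrable_fin_num.
Qed.

Lemma within_square_row v a b y : {within square a b, continuous v} ->
  y \in `[a, b] -> {within `[a, b], continuous (fun t : R => v (t, y))}.
Proof.
move=> /subspace_continuousP cv yab; apply/subspace_continuousP => x xab U.
move=> /(cv (x, y) (conj xab yab)); rewrite /within/=.
have cpair : (fun t : R => (t, y) : R2 R) @ x --> ((x, y) : R2 R).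
  exact: (@cvg_pair R R^o R^o (nbhs x) (nbhs (x : R^o)) (nbhs (y : R^o)) _ _ _
    id (cst y) cvg_id (cvg_cst _)).
move=> /cpair hU.
exact: (@filterS _ (nbhs x) _ _ _ (fun t h tab => h (conj tab yab)) hU).
Qed.

Lemma within_square_col v a b x : {within square a b, continuous v} ->
  x \in `[a, b] -> {within `[a, b], continuous (fun t : R => v (x, t))}.
Proof.
move=> /subspace_continuousP cv xab; apply/subspace_continuousP => y yab U.
move=> /(cv (x, y) (conj xab yab)); rewrite /within/=.
have cpair : (fun t : R => (x, t) : R2 R) @ y --> ((x, y) : R2 R).
  exact: (@cvg_pair R R^o R^o (nbhs y) (nbhs (x : R^o)) (nbhs (y : R^o)) _ _ _
    (cst x) id (cvg_cst _) cvg_id).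
move=> /cpair hU.
exact: (@filterS _ (nbhs y) _ _ _ (fun t h tab => h (conj xab tab)) hU).
Qed.

(** Fubini's theorem, with finitely many exceptional lines discarded. *)
Lemma int2_row_integral0 (O : set (R2 R)) (g : R2 R -> R) (s : seq R) : measurable O ->
  (leb2 R).-integrable O (EFin \o g) ->
  (forall y, y \notin s ->
     mu.-integrable setT (fun x => ((g \_ O) (x, y))%:E) ->
     \int[mu]_x ((g \_ O) (x, y))%:E = 0)%E ->
  int2 O g = 0.
Proof.
move=> mO intg slice0.
have intG : (leb2 R).-integrable setT (EFin \o (g \_ O)).
  rewrite -restrict_EFin.
  exact: (@integrable_mkcond _ _ R (leb2 R) O (EFin \o g) mO).1.
rewrite /int2 /Rintegral integral_mkcond restrict_EFin -integral21_prod_meas1//.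
rewrite (ae_eq_integral (cst 0%E))//; first by rewrite integral0.
  exact: measurable_fubini_G intG.
have nfin : {ae mu, forall y, y \notin s}.
  exists [set y | y \in s]; split.
  - apply: countable_measurable; first exact: measurable_set1.
    exact/finite_set_countable/finite_seq.
  - exact: (finite_lebesgue_null (s := s)).
  - by move=> y /= /negP; rewrite negbK.
have iy := ae_integrable2 intG.
exact: (@filterS2 _ (almost_everywhere mu) _ _ _ _
  (fun y ys iy _ => slice0 y ys iy) nfin iy).
Qed.

Lemma int2_col_integral0 (O : set (R2 R)) (g : R2 R -> R) (s : seq R) : measurable O ->
  (leb2 R).-integrable O (EFin \o g) ->
  (forall x, x \notin s ->
     mu.-integrable setT (fun y => ((g \_ O) (x, y))%:E) ->
     \int[mu]_y ((g \_ O) (x, y))%:E = 0)%E ->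
  int2 O g = 0.
Proof.
move=> mO intg slice0.
have intG : (leb2 R).-integrable setT (EFin \o (g \_ O)).
  rewrite -restrict_EFin.
  exact: (@integrable_mkcond _ _ R (leb2 R) O (EFin \o g) mO).1.
rewrite /int2 /Rintegral integral_mkcond restrict_EFin -integral12_prod_meas1//.
rewrite (ae_eq_integral (cst 0%E))//; first by rewrite integral0.
  exact: measurable_fubini_F intG.
have nfin : {ae mu, forall y, y \notin s}.
  exists [set y | y \in s]; split.
  - apply: countable_measurable; first exact: measurable_set1.
    exact/finite_set_countable/finite_seq.
  - exact: (finite_lebesgue_null (s := s)).
  - by move=> y /= /negP; rewrite negbK.
have iy := ae_integrable1 intG.
exact: (@filterS2 _ (almost_everywhere mu) _ _ _ _
  (fun y ys iy _ => slice0 y ys iy) nfin iy).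
Qed.

Lemma int2_dx_periodic a b Ps Q v : a < b -> separating a b Ps Q ->
  {within square a b, continuous v} -> periodic_on a b v ->
  piecewise_poly (regular_set a b Q) Ps v ->
  int2 (regular_set a b Q) (dx v) = 0.
Proof.
move=> ab sQ cv pv hv; set O := regular_set a b Q.
have oO : open O by exact: open_regular_set sQ.
have [Q0 OI _] := sQ.
have [s hs] := polyfun_cofinite_row Q0.
have hdv := piecewise_dx hv; have hG := piecewise_restrict oO hdv.
apply: (@int2_row_integral0 _ _ s); first exact: open_measurable2.
  exact: piecewise_integrable oO (@regular_subset _ a b Q) hdv.
move=> y /hs[t ht] intf; have [yab|yab] := boolP (y \in `]a, b[); last first.
  rewrite (eq_integral (cst 0%E)) ?integral0// => x _.
  rewrite patchE; case: ifPn => //; rewrite inE => /OI/andP[_ /=].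
  by rewrite (negbTE yab).
have yab' : y \in `[a, b] by exact: subset_itv_oo_cc.
apply: (@slice_integral0 t (fun x => v (x, y)) _ a b) => //.
- exact: within_square_row.
- by have [] := pv y; rewrite in_itv in yab'.
- move=> x xab; rewrite patchE; case: ifPn => //; rewrite inE => /OI/andP[/=].
  by rewrite (negbTE xab).
move=> x xab xt; have Oxy : O (x, y).
  split; first by split; [exact: subset_itv_oo_cc|].
  by apply: contra xt => /eqP; exact: ht.
have cpair : (fun r : R => (r, y) : R2 R) @ x --> ((x, y) : R2 R).
  exact: (@cvg_pair R R^o R^o (nbhs x) (nbhs (x : R^o)) (nbhs (y : R^o)) _ _ _
    id (cst y) cvg_id (cvg_cst _)).
split.
- have [P _ vP] := hv _ Oxy.
  have vP' : \forall r \near x, polyfun P (r, y) = v (r, y).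
    exact: (@filterS _ (nbhs x) _ _ _ (fun r e => esym e) (cpair _ vP)).
  by apply: near_eq_derivable vP' _; have [] := is_derive_polyfun_row P x y.
- by rewrite -dxE patchE mem_set.
- exact: cvg_comp cpair (piecewise_continuous hG Oxy).
Qed.

Lemma int2_dy_periodic a b Ps Q v : a < b -> separating a b Ps Q ->
  {within square a b, continuous v} -> periodic_on a b v ->
  piecewise_poly (regular_set a b Q) Ps v ->
  int2 (regular_set a b Q) (dy v) = 0.
Proof.
move=> ab sQ cv pv hv; set O := regular_set a b Q.
have oO : open O by exact: open_regular_set sQ.
have [Q0 OI _] := sQ.
have [s hs] := polyfun_cofinite_col Q0.
have hdv := piecewise_dy hv; have hG := piecewise_restrict oO hdv.
apply: (@int2_col_integral0 _ _ s); first exact: open_measurable2.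
  exact: piecewise_integrable oO (@regular_subset _ a b Q) hdv.
move=> x /hs[t ht] intf; have [xab|xab] := boolP (x \in `]a, b[); last first.
  rewrite (eq_integral (cst 0%E)) ?integral0// => y _.
  rewrite patchE; case: ifPn => //; rewrite inE => /OI/andP[/=].
  by rewrite (negbTE xab).
have xab' : x \in `[a, b] by exact: subset_itv_oo_cc.
apply: (@slice_integral0 t (fun y => v (x, y)) _ a b) => //.
- exact: within_square_col.
- by have [] := pv x; rewrite in_itv in xab'.
- move=> y yab; rewrite patchE; case: ifPn => //; rewrite inE => /OI/andP[_ /=].
  by rewrite (negbTE yab).
move=> y yab yt; have Oxy : O (x, y).
  split; first by split; [|exact: subset_itv_oo_cc].
  by apply: contra yt => /eqP; exact: ht.
have cpair : (fun r : R => (x, r) : R2 R) @ y --> ((x, y) : R2 R).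
  exact: (@cvg_pair R R^o R^o (nbhs y) (nbhs (x : R^o)) (nbhs (y : R^o)) _ _ _
    (cst x) id (cvg_cst _) cvg_id).
split.
- have [P _ vP] := hv _ Oxy.
  have vP' : \forall r \near y, polyfun P (x, r) = v (x, r).
    exact: (@filterS _ (nbhs y) _ _ _ (fun r e => esym e) (cpair _ vP)).
  by apply: near_eq_derivable vP' _; have [] := is_derive_polyfun_col P x y.
- by rewrite -dyE patchE mem_set.
- exact: cvg_comp cpair (piecewise_continuous hG Oxy).
Qed.

End GradientIntegral.

(** * Finite element functions as selections of polynomials *)

Section FiniteElements.
Variable R : realType.
Implicit Types (v w : R2 R -> R).

(** The inverse of an affine bijection is affine, and so given by two polynomials
    of degree one. *)
Lemma affine_iso_inverse (T : R2 R -> R2 R) : affine_iso T ->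
  exists A B : {poly {poly R}}, forall p, (polyfun A (T p), polyfun B (T p)) = p.
Proof.
case=> L [t [bL TE]]; have [g gK Lg] := bL.
pose e1 := g (1, 0); pose e2 := g (0, 1).
have coord (q : R2 R) : g q = q.1 *: e1 + q.2 *: e2.
  apply: (bij_inj bL); rewrite Lg linearD !linearZ/= !Lg.
  by case: q => x y; congr (_, _); rewrite /= /GRing.scale/= ?mulr1 ?mulr0 ?addr0 ?add0r.
pose lin (k l : R) : {poly {poly R}} :=
  k%:P%:P * ('X - t.1%:P%:P) + l%:P%:P * ('X%:P - t.2%:P%:P).
have linE k l p : polyfun (lin k l) (T p) = k * (L p).1 + l * (L p).2.
  rewrite polyfunD !polyfunM !polyfunB polyfunX polyfunY !polyfunC TE /=.
  by rewrite !addrK.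
exists (lin e1.1 e2.1), (lin e1.2 e2.2) => p; rewrite !linE.
rewrite -[RHS](gK p) coord; congr (_, _);
  by rewrite /= /GRing.scale/= ![_ * (L p).1]mulrC ![_ * (L p).2]mulrC.
Qed.

Variables (E : ref_element R) (a b : R) (M : mesh E (square a b)).

(** On the cell K, v is the polynomial obtained from the reference one by
    composition with the inverse of the affine map of K; the list contains one
    such polynomial per cell. *)
Lemma fe_space_selection v : fe_space M v ->
  exists Ps : seq {poly {poly R}}, forall p, square a b p ->
    exists2 P, P \in Ps & v p = polyfun P p.
Proof.
case=> _ _ hv.
have : forall K : cell_index M, exists P : {poly {poly R}}, forall p,
    ref_cell E p -> v (geom K p) = polyfun P (geom K p).
  move=> K; have [q _ hq] := hv K.
  have [A [B AB]] := affine_iso_inverse (geom_affine K).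
  have [P hP] := polyfun_comp q A B; exists P => p Ep.
  by rewrite hq// hP AB.
move=> /choice[P hP]; exists [seq P K | K <- enum (cell_index M)] => p.
move=> Dp; have := eq_ind_r (fun A : set (R2 R) => A p) Dp (mesh_cover M).
case=> K _ [r Er rp]; rewrite -rp; exists (P K); last exact: hP.
by apply: map_f; rewrite mem_enum.
Qed.

Lemma ref_space0 : ref_space E 0.
Proof.
have [s ->] := ref_finite_dim E; exists (fun=> 0).
by rewrite big1// => k _; rewrite scale0r.
Qed.

Lemma ref_space_lin (k : R) P Q : ref_space E P -> ref_space E Q ->
  ref_space E (k%:P *: P + Q).
Proof.
have [s ->] := ref_finite_dim E => -[al ->] [be ->].
exists (fun i => k * al i + be i); rewrite scaler_sumr -big_split/=.
by apply: eq_bigr => i _; rewrite scalerA -scalerDl polyCD polyCM.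
Qed.

Lemma fe_space0 : fe_space M (fun=> 0).
Proof.
split; first by apply: continuous_subspaceT => p; exact: cvg_cst.
- by [].
- move=> K; exists 0; first exact: ref_space0.
  by move=> p _; rewrite /polyfun !horner0.
Qed.

Lemma fe_space_lin k v w : fe_space M v -> fe_space M w ->
  fe_space M (fun p => k * v p + w p).
Proof.
move=> [cv pv hv] [cw pw hw]; split.
- move=> p; apply: cvgD; last exact: cw.
  by apply: cvgMr; exact: cv.
- move=> s sab; have [[-> ->] [-> ->]] := (pv s sab, pw s sab); by [].
- move=> K; have [[P EP hP] [Q EQ hQ]] := (hv K, hw K).
  exists (k%:P *: P + Q); first exact: ref_space_lin.
  move=> p Ep; rewrite hP// hQ// polyfunD -mul_polyC polyfunM polyfunC//.
Qed.

Lemma fe_space_fe_fun N (phi : 'I_N -> R2 R -> R) V :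
  (forall i, fe_space M (phi i)) -> fe_space M (fe_fun phi V).
Proof.
move=> hphi; rewrite /fe_fun; elim: (index_enum _) => [|i r IH].
  rewrite (_ : (fun p => _) = fun=> 0); first exact: fe_space0.
  by apply/funext => p; rewrite big_nil.
rewrite (_ : (fun p => _) =
    fun p => V i * phi i p + \sum_(j <- r) V j * phi j p).
  exact: (fe_space_lin _ (hphi i) IH).
by apply/funext => p; rewrite big_cons.
Qed.

End FiniteElements.

(** * Mass conservation *)

Section IntegralLinearity.
Variable R : realType.

Lemma eq_int2 (O : set (R2 R)) (g h : R2 R -> R) :
  (forall p, O p -> g p = h p) -> int2 O g = int2 O h.
Proof. by move=> gh; apply: eq_Rintegral => p; rewrite inE => /gh. Qed.

Lemma int2_eq0 (O : set (R2 R)) (g : R2 R -> R) :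
  (forall p, O p -> g p = 0) -> int2 O g = 0.
Proof.
move=> g0; rewrite (eq_int2 (h := cst 0))//.
by rewrite /int2 /Rintegral integral0.
Qed.

Lemma int2_sum (O : set (R2 R)) (I : Type) (r : seq I) (k : I -> R)
    (G : I -> R2 R -> R) : measurable O ->
  (forall i, (leb2 R).-integrable O (EFin \o G i)) ->
  int2 O (fun p => \sum_(i <- r) k i * G i p) = \sum_(i <- r) k i * int2 O (G i).
Proof.
move=> mO intG.
have intkG i : (leb2 R).-integrable O (EFin \o (fun p => k i * G i p)).
  exact: (@integrableZl _ _ R (leb2 R) O mO (k i) (EFin \o G i) (intG i)).
have intS s : (leb2 R).-integrable O (EFin \o (fun p => \sum_(i <- s) k i * G i p)).
  have := @integrable_sum _ _ R (leb2 R) O mO I s xpredT _ (fun i _ => intkG i).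
  by apply: eq_integrable => // p _ /=; rewrite sumEFin.
elim: r => [|i r IH].
  by rewrite big_nil int2_eq0// => p _; rewrite big_nil.
rewrite big_cons -IH /int2 -RintegralZl// -RintegralD//.
by apply: eq_Rintegral => p _; rewrite big_cons.
Qed.

End IntegralLinearity.

Lemma sum_antisymmetric (R : realType) (I : finType) (F : I -> I -> R) :
  (forall i j, F i j = - F j i) -> \sum_i \sum_j F i j = 0.
Proof.
move=> antiF; have : \sum_i \sum_j F i j = - \sum_i \sum_j F i j.
  rewrite {1}exchange_big /= -sumrN; apply: eq_bigr => i _.
  by rewrite -sumrN; apply: eq_bigr => j _.
by move/eqP; rewrite -subr_eq0 opprK -mulr2n mulrn_eq0 => /eqP.
Qed.

Lemma mass_difference0 (R : realType) (I : finType) (m U W : I -> R) (tau : R) :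
  0 < tau -> \sum_i m i * ((U i - W i) / tau) = 0 ->
  \sum_i m i * U i = \sum_i m i * W i.
Proof.
move=> tau0; under eq_bigr => i _ do rewrite mulrA mulrBr.
rewrite -mulr_suml sumrB => /eqP.
by rewrite mulf_eq0 invr_eq0 (gt_eqF tau0) orbF subr_eq0 => /eqP.
Qed.

(** Sum the scheme over i: the fluxes vanish after exchanging the two sums, the
    viscous terms by antisymmetry. *)
Lemma graph_scheme_conservative (R : realType) (I : finType) (S : I -> I -> Prop)
    (c : I -> I -> R2 R) (d : I -> I -> R) (F : I -> R2 R) (m U W : I -> R)
    (tau : R) : 0 < tau ->
  (forall j, \sum_i (c i j).1 = 0 /\ \sum_i (c i j).2 = 0) ->
  (forall i j, ~ S i j -> c i j = 0) ->
  (forall i j, d i j = d j i) -> (forall i j, ~ S i j -> d i j = 0) ->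
  (forall i, m i * ((W i - U i) / tau)
     + \sum_(j | `[< S i j >]) (dotp (F j) (c i j) - d i j * (U j - U i)) = 0) ->
  \sum_i m i * W i = \sum_i m i * U i.
Proof.
move=> tau0 sumc c0 dsym d0 step; apply: (mass_difference0 tau0).
have flux0 : \sum_i \sum_j dotp (F j) (c i j) = 0.
  rewrite exchange_big big1//= => j _; have [c1 c2] := sumc j.
  by rewrite /dotp big_split/= -!mulr_sumr c1 c2 !mulr0 addr0.
have visc0 : \sum_i \sum_j d i j * (U j - U i) = 0.
  by apply: sum_antisymmetric => i j; rewrite dsym -mulrN opprB.
have : \sum_i (m i * ((W i - U i) / tau) +
    \sum_j (dotp (F j) (c i j) - d i j * (U j - U i))) = 0.
  rewrite big1// => i _; rewrite -[RHS](step i) [X in _ = _ + X]big_mkcond/=.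
  congr (_ + _); apply: eq_bigr => j _; case: asboolP => // nij.
  by rewrite c0// d0// /dotp !mulr0 mul0r subr0 addr0.
rewrite big_split/=; under [X in _ + X]eq_bigr => i _ do rewrite sumrB.
by rewrite sumrB flux0 visc0 subrr addr0.
Qed.

Section Conservation.
Variables (R : realType) (a b : R) (E : ref_element R) (M : mesh E (square a b)).
Variables (N : nat) (phi : 'I_N -> R2 R -> R).
Hypothesis hab : a < b.
Hypothesis hphi : forall i, fe_space M (phi i).
Hypothesis hunity : forall p, square a b p -> \sum_(i < N) phi i p = 1.
Local Notation D := (square a b).

(** One list of polynomials, and hence one regular set, serves all the shape
    functions. *)
Lemma shape_functions_piecewise : exists Ps Q, separating a b Ps Q /\
  forall i, piecewise_poly (regular_set a b Q) Ps (phi i).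
Proof.
have /choice[P hP] := fun i => fe_space_selection (hphi i).
pose Ps := flatten [seq P i | i <- enum 'I_N].
have [Q sQ] := separating_exists a b Ps; exists Ps, Q; split => // i.
apply: selection_piecewise => //; first by have [] := hphi i.
move=> p Dp; have [P' P'P ->] := hP i p Dp; exists P' => //.
by apply/flattenP; exists (P i) => //; rewrite map_f ?mem_enum.
Qed.

Variables (Ps : seq {poly {poly R}}) (Q : {poly {poly R}}).
Hypothesis sQ : separating a b Ps Q.
Hypothesis phiP : forall i, piecewise_poly (regular_set a b Q) Ps (phi i).
Local Notation O := (regular_set a b Q).

Let oO : open O. Proof. exact: open_regular_set sQ. Qed.
Let mO : measurable O. Proof. exact: open_measurable2. Qed.
Let int2O g : int2 D g = int2 O g.
Proof. by have [Q0 _ _] := sQ; exact: int2_regular. Qed.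
Let nearO p : O p -> nbhs p O. Proof. by move=> Op; exact: open_nbhs_nbhs. Qed.

Lemma int2_fe_fun V : int2 D (fe_fun phi V) = \sum_(i < N) lumped_mass D phi i * V i.
Proof.
rewrite int2O /fe_fun int2_sum//.
  by apply: eq_bigr => i _; rewrite mulrC /lumped_mass int2O.
by move=> i; exact: piecewise_integrable oO (@regular_subset _ a b Q) (phiP i).
Qed.

(** Partition of unity under the integral sign. *)
Lemma sum_phi_deriv (dv : R2 R -> R) Qs : piecewise_poly O Qs dv ->
  \sum_(i < N) inner D (phi i) dv = int2 O dv.
Proof.
move=> hdv; under eq_bigr => i _ do rewrite /inner int2O -[int2 _ _]mul1r.
rewrite -int2_sum//; last first.
  move=> i; have h := piecewise_mul (phiP i) hdv.
  exact: piecewise_integrable oO (@regular_subset _ a b Q) h.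
apply: eq_int2 => p Op; under eq_bigr => i _ do rewrite mul1r.
by rewrite -mulr_suml hunity ?mul1r//; exact: regular_subset Op.
Qed.

Lemma sum_cvec j : \sum_(i < N) (cvec D phi i j).1 = 0 /\
  \sum_(i < N) (cvec D phi i j).2 = 0.
Proof.
have [cj pj _] := hphi j; split.
- rewrite /= (sum_phi_deriv (piecewise_dx (phiP j))).
  exact: int2_dx_periodic hab sQ cj pj (phiP j).
- rewrite /= (sum_phi_deriv (piecewise_dy (phiP j))).
  exact: int2_dy_periodic hab sQ cj pj (phiP j).
Qed.

(** Where phi_i is nonzero, phi_j is zero in a neighbourhood, and so is its
    gradient. *)
Lemma cvec_out_stencil i j : ~ stencil D phi i j -> cvec D phi i j = 0.
Proof.
move=> nij; have phiphi p : D p -> phi j p * phi i p = 0.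
  move=> Dp; have [//|ne] := eqVneq (phi j p * phi i p) 0.
  by exfalso; apply: nij; exists p.
have phij0 p : O p -> phi i p != 0 -> \forall q \near p, phi j q = 0.
  move=> Op ip; have nz : \forall q \near p, phi i q != 0.
    exact: (cvgr_neq0 _ (piecewise_continuous (phiP i) Op) ip).
  apply: filterS2 (nearO Op) nz => q Oq iq.
  have /eqP := phiphi q (regular_subset Oq).
  by rewrite mulf_eq0 (negbTE iq) orbF => /eqP.
rewrite /cvec /inner !int2O; congr (_, _); apply: int2_eq0 => p Op;
  (have [->|ip] := eqVneq (phi i p) 0; first by rewrite mul0r).
- rewrite (near_eq_dx (w := fun=> 0)) ?mulr0//; last exact: phij0.
  by rewrite /dx derive_cst mulr0.
- rewrite (near_eq_dy (w := fun=> 0)) ?mulr0//; last exact: phij0.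
  by rewrite /dy derive_cst mulr0.
Qed.

Lemma stencil_sym i j : stencil D phi i j -> stencil D phi j i.
Proof. by case=> p Dp; rewrite mulrC; exists p. Qed.

Lemma viscosity_out_stencil lam U i j : ~ stencil D phi i j ->
  graph_viscosity D phi lam U i j = 0.
Proof.
move=> nij; have nji : ~ stencil D phi j i by move=> /stencil_sym.
rewrite /graph_viscosity !cvec_out_stencil// /norm2 /dotp /=.
by rewrite !mul0r addr0 sqrtr0 !mulr0 maxxx.
Qed.

Lemma viscosity_sym lam U i j :
  graph_viscosity D phi lam U i j = graph_viscosity D phi lam U j i.
Proof. rewrite /graph_viscosity /=; exact: maxC. Qed.

Lemma graph_viscosity_conservative lam f tau U W : 0 < tau ->
  graph_viscosity_step D phi lam f tau U W ->
  \sum_(i < N) lumped_mass D phi i * W i = \sum_(i < N) lumped_mass D phi i * U i.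
Proof.
move=> tau0 step; apply: (graph_scheme_conservative (S := stencil D phi)
  (c := cvec D phi) (d := graph_viscosity D phi lam U) (F := fun j => f (U j))
  tau0 _ _ _ _ step).
- exact: sum_cvec.
- exact: cvec_out_stencil.
- exact: viscosity_sym.
- exact: viscosity_out_stencil.
Qed.

Lemma fe_fun1 p : D p -> fe_fun phi (fun=> 1) p = 1.
Proof.
by move=> Dp; rewrite /fe_fun -[RHS](hunity Dp); apply: eq_bigr => i _; rewrite mul1r.
Qed.

Lemma regularization_fe_fun1 eps c u z g :
  regularization_terms D eps c u z g (fe_fun phi (fun=> 1)) = 0.
Proof.
have near1 p : O p -> \forall q \near p, fe_fun phi (fun=> 1) q = 1.
  by move=> Op; apply: filterS (nearO Op) => q Oq; apply/fe_fun1/regular_subset/Oq.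
have dx0 w : inner D w (dx (fe_fun phi (fun=> 1))) = 0.
  rewrite /inner int2O; apply: int2_eq0 => p /near1 h.
  by rewrite (near_eq_dx (w := fun=> 1) h) /dx derive_cst mulr0.
have dy0 w : inner D w (dy (fe_fun phi (fun=> 1))) = 0.
  rewrite /inner int2O; apply: int2_eq0 => p /near1 h.
  by rewrite (near_eq_dy (w := fun=> 1) h) /dy derive_cst mulr0.
by rewrite /regularization_terms !dx0 !dy0 !mulr0 !subr0.
Qed.

(** Both versions of the system, tested with the constant 1, reduce to the same
    identity between the coefficients. *)
Lemma regularization_conservative eps c tau U W z g : 0 < tau ->
  consistent_system D (fe_space M) eps c tau (fe_fun phi U) (fe_fun phi W) z g \/
  lumped_system D (fe_space M) phi eps c tau U W z g ->
  \sum_(i < N) lumped_mass D phi i * U i = \sum_(i < N) lumped_mass D phi i * W i.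
Proof.
move=> tau0 sys.
apply: (mass_difference0 tau0).
case: sys => -[eq1 _].
- have := eq1 _ (fe_space_fe_fun (fun=> 1) hphi).
  rewrite regularization_fe_fun1 addr0 => {2}<-; rewrite -int2_fe_fun.
  apply: eq_int2 => p Dp; rewrite fe_fun1// mulr1 /fe_fun -sumrB mulr_suml.
  by apply: eq_bigr => i _; rewrite -mulrBl mulrAC.
- have := eq1 (fun=> 1); rewrite regularization_fe_fun1 addr0 => {2}<-.
  by apply: eq_bigr => i _; rewrite mulr1.
Qed.

End Conservation.

Theorem mainTheorem3 (R : realType) (a b : R) (hab : a < b)
  (f : R -> R2 R) (hf : lipschitz (f : R^o -> R2 R))
  (eps c : R) (heps : 0 < eps) (hc : 0 < c)
  (tau : nat -> R) (htau : forall n, 0 < tau n)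
  (E : ref_element R) (H : Type) (meshes : H -> mesh E (square a b))
  (hreg : shape_regular meshes) (h : H)
  (N : nat) (phi : 'I_N -> R2 R -> R)
  (hbasis : fe_basis (square a b) (fe_space (meshes h)) phi)
  (hunity : forall p, square a b p -> \sum_(i < N) phi i p = 1)
  (hmass : forall i, 0 < lumped_mass (square a b) phi i)
  (lam : R2 R -> R -> R -> R)
  (hlam : forall (nu : R2 R) (UL UR : R), norm2 nu = 1 ->
     wave_speed_bound (fun s => dotp (f s) nu) UL UR (lam nu UL UR))
  (U W : nat -> 'I_N -> R) (z g : nat -> R2 R -> R)
  (hz : forall n, fe_space (meshes h) (z n.+1))
  (hg : forall n, fe_space (meshes h) (g n.+1))
  (hW : forall n,
     graph_viscosity_step (square a b) phi lam f (tau n) (U n) (W n.+1))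
  (hU : forall n,
     consistent_system (square a b) (fe_space (meshes h)) eps c (tau n)
       (fe_fun phi (U n.+1)) (fe_fun phi (W n.+1)) (z n.+1) (g n.+1)
     \/ lumped_system (square a b) (fe_space (meshes h)) phi eps c (tau n)
       (U n.+1) (W n.+1) (z n.+1) (g n.+1)) :
  forall n k : nat, (k <= n)%N ->
    int2 (square a b) (fe_fun phi (U n.+1)) = int2 (square a b) (fe_fun phi (U k)).
Proof.
have hphi i : fe_space (meshes h) (phi i) by have [] := hbasis.
have [Ps [Q [sQ phiP]]] := shape_functions_piecewise hphi.
have step n : int2 (square a b) (fe_fun phi (U n.+1)) =
              int2 (square a b) (fe_fun phi (U n)).
  rewrite !(int2_fe_fun sQ phiP).
  rewrite (regularization_conservative hphi hunity sQ phiP (htau n) (hU n)).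
  exact: (graph_viscosity_conservative hab hphi hunity sQ phiP (htau n) (hW n)).
move=> n k; elim: n => [|n IH]; first by rewrite leqn0 => /eqP ->.
rewrite leq_eqVlt => /predU1P[-> //|]; rewrite ltnS => /IH <-.
exact: step.
Qed.
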